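(* There exists an infinite and co-infinite set $A\subset\mathbb{N}$ such that the two-point represented space $D_A$ is not computably Hausdorff.
   Context: A represented space $\mathbf{X}=(X,\delta_{\mathbf{X}})$ is a set $X$ with a partial surjection $\delta_{\mathbf{X}}:\subseteq\mathbb{N}^{\mathbb{N}}\to X$; any $p$ with $\delta_{\mathbf X}(p)=x$ is a name of $x$. A map $f:\mathbf{X}\to\mathbf{Y}$ is computable if some computable partial map on $\mathbb{N}^{\mathbb{N}}$ sends every name of every $x\in X$ to a name of $f(x)$. In the product $\mathbf{X}\times\mathbf{Y}$, $p$ names $(x,y)$ iff $n\mapsto p(2n)$ names $x$ and $n\mapsto p(2n+1)$ names $y$. Sierpinski space $\mathbb{S}=\{\top,\bot\}$ is represented so that $0^\omega$ names $\bot$ and every other sequence names $\top$. A subset of $\mathbf{X}$ is computably open if its characteristic function $\mathbf{X}\to\mathbb{S}$ (value $\top$ exactly on the set) is computable, and computably closed if its complement is computably open. $\mathbf{X}$ is computably Hausdorff if the diagonal $\{(x,x)\}\subseteq\mathbf{X}\times\mathbf{X}$ is computably closed. For an infinite and co-infinite $A\subset\mathbb{N}$, $D_A$ is the represented space with underlying set $\{a,b\}$ (two distinct points) where $p$ is a name for $a$ iff $p$ is obtained from the characteristic function of $A$ by replacing finitely many $1$s with $0$s, and $p$ is a name for $b$ iff it is obtained from the characteristic function of $\mathbb{N}\setminus A$ by replacing finitely many $1$s with $0$s. *)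

(* Defs.v *)
From mathcomp Require Import all_boot.
From mathcomp Require Import boolp classical_sets functions cardinality.

Set Implicit Arguments.
Unset Strict Implicit.
Unset Printing Implicit Defensive.

Local Open Scope classical_set_scope.

Definition baire := nat -> nat.

(** Computability on Baire space: register (counter) programs with loops and
    an oracle.  This model is Turing complete relative to the oracle.  The
    registers are indexed by [nat] and hold natural numbers. *)
Inductive prog :=
| Inc of nat
| Dec of nat
| Ask of nat
| Seq of prog & prog
| While of nat & prog.

(** [exec p c s t]: with oracle [p], program [c] started in the register
    contents [s] halts with register contents [t].  [Ask i] replaces the
    contents [k] of register [i] by [p k]; [While i c] iterates [c] as long as
    register [i] is nonzero. *)
Inductive exec (p : baire) : prog -> (nat -> nat) -> (nat -> nat) -> Prop :=
| exec_inc i s : exec p (Inc i) s [eta s with i |-> (s i).+1]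
| exec_dec i s : exec p (Dec i) s [eta s with i |-> (s i).-1]
| exec_ask i s : exec p (Ask i) s [eta s with i |-> p (s i)]
| exec_seq c d s t u : exec p c s t -> exec p d t u -> exec p (Seq c d) s u
| exec_stop i c s : s i = 0 -> exec p (While i c) s s
| exec_loop i c s t u : s i <> 0 ->
    exec p c s t -> exec p (While i c) t u -> exec p (While i c) s u.

(** Graph of the partial map on Baire space computed by [c]: its value at [p]
    is [q] iff, for every [n], the program with oracle [p], input [n] in
    register 0 and all other registers 0 halts with [q n] in register 0.  The
    computable partial maps are those of the form [computes c]. *)
Definition computes (c : prog) (p q : baire) : Prop :=
  forall n, exists2 s, exec p c [eta (fun=> 0) with 0 |-> n] s & s 0 = q n.

Lemma exec_det p c s t u : exec p c s t -> exec p c s u -> t = u.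
Proof.
move=> st; elim: st u => {c s t} [i s|i s|i s|c d s t u _ IHc _ IHd|i c s s0
  |i c s t u ns0 _ IHc _ IHw] v sv; inversion sv => //; subst.
- by apply: IHd; match goal with H : exec p c _ _ |- _ => rewrite (IHc _ H) end.
- by [].
- by apply: IHw; match goal with H : exec p c _ _ |- _ => rewrite (IHc _ H) end.
Qed.

Lemma computes_functional c p q q' : computes c p q -> computes c p q' -> q = q'.
Proof.
move=> cq cq'; apply/funext => n.
have [s es <-] := cq n; have [s' es' <-] := cq' n.
by rewrite (exec_det es es').
Qed.

(** The partial surjection is given by its graph: [names X p x] says that [p]
    is in its domain and is mapped to [x]. *)
Record repSpace := RepSpace {
  carrier :> Type;
  names : baire -> carrier -> Prop;
  names_functional : forall p x y, names p x -> names p y -> x = y;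
  names_surjective : forall x, exists p, names p x }.

Definition computable (X Y : repSpace) (f : X -> Y) : Prop :=
  exists c : prog, forall (p : baire) (x : X), names p x ->
    exists2 q : baire, computes c p q & names q (f x).

Definition prod_names (X Y : repSpace) (p : baire) (z : X * Y) : Prop :=
  names (fun n => p n.*2) z.1 /\ names (fun n => p n.*2.+1) z.2.

Lemma prod_names_functional (X Y : repSpace) p (z w : X * Y) :
  prod_names p z -> prod_names p w -> z = w.
Proof.
case: z w => [x y] [x' y'] [/= px py] [/= px' py'].
by rewrite (names_functional px px') (names_functional py py').
Qed.

Lemma prod_names_surjective (X Y : repSpace) (z : X * Y) :
  exists p, prod_names p z.
Proof.
case: z => x y.
have [p px] := names_surjective x; have [q qy] := names_surjective y.
exists (fun n => if odd n then q n./2 else p n./2); split => /=.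
- by under eq_fun do rewrite odd_double doubleK.
- by under eq_fun do rewrite odd_double uphalf_double.
Qed.

Definition prod_space (X Y : repSpace) : repSpace :=
  RepSpace (@prod_names_functional X Y) (@prod_names_surjective X Y).

(** Sierpinski space, with [true] as the top and [false] as the bottom point. *)
Definition sierpinski_names (p : baire) (b : bool) : Prop :=
  b = false <-> forall n, p n = 0.

Lemma sierpinski_names_functional p b b' :
  sierpinski_names p b -> sierpinski_names p b' -> b = b'.
Proof.
rewrite /sierpinski_names => pb pb'.
by case: b b' pb pb' => [] [] // [h1 h2] [h3 h4];
  [have := h2 (h3 erefl)|have := h4 (h1 erefl)].
Qed.

Lemma sierpinski_names_surjective b : exists p, sierpinski_names p b.
Proof.
exists (fun=> nat_of_bool b); case: b; split => //.
by move=> /(_ 0).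
Qed.

Definition sierpinski : repSpace :=
  RepSpace sierpinski_names_functional sierpinski_names_surjective.

Definition computably_open (X : repSpace) (U : set X) : Prop :=
  @computable X sierpinski (fun x => `[< U x >]).

Definition computably_closed (X : repSpace) (C : set X) : Prop :=
  computably_open (~` C).

Definition computably_hausdorff (X : repSpace) : Prop :=
  @computably_closed (prod_space X X) [set z | z.1 = z.2].

Definition char_fun (A : set nat) : baire := fun n => `[< A n >] : nat.

(** [p] arises from the characteristic function of [A] by replacing the 1s at
    the finitely many positions in [F] by 0s. *)
Definition finitely_reduced (A : set nat) (p : baire) : Prop :=
  exists F : set nat,
    [/\ finite_set F, F `<=` A
      & forall n, p n = if `[< F n >] then 0 else char_fun A n].

Inductive two_points := pt_a | pt_b.

Definition D_names (A : set nat) (p : baire) (x : two_points) : Prop :=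
  match x with
  | pt_a => finitely_reduced A p
  | pt_b => finitely_reduced (~` A) p
  end.

Lemma finitely_reduced_disjoint (A : set nat) p : infinite_set A ->
  finitely_reduced A p -> finitely_reduced (~` A) p -> False.
Proof.
move=> infA [F [finF _ pF]] [G [_ _ pG]].
have [n [An nF]] : (A `\` F) !=set0.
  by apply: infinite_setN0; apply: infinite_setD.
move: (pF n); rewrite pG (asboolF nF) /char_fun (asboolT An).
by rewrite [`[< (~` A) n >]]asboolF; [case: ifP|move=> /(_ An)].
Qed.

Lemma finitely_reduced_char (A : set nat) : finitely_reduced A (char_fun A).
Proof.
by exists set0; split=> // n; rewrite [`[< set0 n >]]asboolF.
Qed.

Section TwoPointSpace.
Variables (A : set nat) (infA : infinite_set A).

Lemma D_names_functional p x y : D_names A p x -> D_names A p y -> x = y.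
Proof.
case: x y => [] [] //= h h'; first by case: (finitely_reduced_disjoint infA h h').
by case: (finitely_reduced_disjoint infA h' h).
Qed.

Lemma D_names_surjective x : exists p, D_names A p x.
Proof.
by case: x; [exists (char_fun A)|exists (char_fun (~` A))];
  apply: finitely_reduced_char.
Qed.

Definition D_space (coinfA : infinite_set (~` A)) : repSpace :=
  RepSpace D_names_functional D_names_surjective.

End TwoPointSpace.

(* Main.v *)
From HB Require Import structures.
Require Import Defs.
From mathcomp Require Import all_boot.
From mathcomp Require Import boolp classical_sets functions cardinality.
Local Open Scope classical_set_scope.

(** The set [A] is built by finite extension, defeating one program [c] at a
    time.  Let [A] be decided below [n], and consider the partitions [g] of the
    numbers [>= n].  If for some [g] the program accepts the pair consisting of
    the two halves of [g], it does so after reading a finite part of it; putting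
    all numbers of a long enough interval [[n, n + N[] into [A] turns this
    finite part into a part of a name of [(a, a)], which [c] wrongly accepts.
    If there is no such [g], then for every [A] the program fails to accept the
    name of [(a, b)] obtained by erasing all 1s below [n]. *)

Fixpoint tree_of_prog (c : prog) : GenTree.tree nat :=
  match c with
  | Inc i => GenTree.Node 0 [:: GenTree.Leaf i]
  | Dec i => GenTree.Node 1 [:: GenTree.Leaf i]
  | Ask i => GenTree.Node 2 [:: GenTree.Leaf i]
  | Seq c d => GenTree.Node 3 [:: tree_of_prog c; tree_of_prog d]
  | While i c => GenTree.Node 4 [:: GenTree.Leaf i; tree_of_prog c]
  end.

Fixpoint prog_of_tree (t : GenTree.tree nat) : option prog :=
  match t with
  | GenTree.Node 0 [:: GenTree.Leaf i] => Some (Inc i)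
  | GenTree.Node 1 [:: GenTree.Leaf i] => Some (Dec i)
  | GenTree.Node 2 [:: GenTree.Leaf i] => Some (Ask i)
  | GenTree.Node 3 [:: t; u] =>
      if (prog_of_tree t, prog_of_tree u) is (Some c, Some d)
      then Some (Seq c d) else None
  | GenTree.Node 4 [:: GenTree.Leaf i; t] => omap (While i) (prog_of_tree t)
  | _ => None
  end.

Lemma tree_of_progK : pcancel tree_of_prog prog_of_tree.
Proof. by elim=> //= [c -> d ->|i c ->]. Qed.

(** Countability gives each program a code, hence a stage of the construction at which it is dealt
    with. *)
HB.instance Definition _ := Countable.copy prog (pcan_type tree_of_progK).

(** A Baire category argument: from the empty word on, stage [k] appends an extension meeting the
    requirement with code [k]. The words are nested, hence prefixes of one sequence. *)
Lemma generic_sequence (I : countType) (U : I -> seq bool -> Prop) :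
  (forall i s, exists t, U i (s ++ t)) ->
  exists g : nat -> bool, forall i, exists m, U i (mkseq g m).
Proof.
move=> denseU.
have [step stepP] := choice (fun x : I * seq bool => denseU x.1 x.2).
pose fix w k := if k is k'.+1 then
  w k' ++ (if unpickle k' is Some i then step (i, w k') else [::]) else [::].
have wD k d : exists u, w (k + d) = w k ++ u.
  elim: d => [|d [u IH]]; first by exists [::]; rewrite addn0 cats0.
  by rewrite addnS /= IH -catA; eexists.
have nth_w k l n : n < size (w k) -> n < size (w l) ->
    nth false (w k) n = nth false (w l) n.
  wlog kl : k l / k <= l => [hw nk nl|nk _].
    by case/orP: (leq_total k l) => ?; [apply: hw|apply/esym/hw].
  by have [u] := wD k (l - k); rewrite subnKC // => ->; rewrite nth_cat nk.
(* Positions that no stage reaches get the value [false]. *)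
exists (fun n => `[< exists2 k, n < size (w k) & nth false (w k) n >]) => i.
exists (size (w (pickle i).+1)).
suff -> : mkseq (fun n => `[< exists2 k, n < size (w k) & nth false (w k) n >])
    (size (w (pickle i).+1)) = w (pickle i).+1.
  by rewrite /= pickleK; apply: (stepP (i, _)).
apply: (@eq_from_nth _ false) => [|n]; rewrite size_mkseq // => nw.
rewrite nth_mkseq //; apply/asboolP/idP => [[k nk]|]; last by exists (pickle i).+1.
by rewrite (nth_w _ _ _ nk nw).
Qed.

(** A halting run asks the oracle only finitely many questions; [N] exceeds them all. *)
Lemma exec_use {p c s t} : exec p c s t ->
  exists N, forall p', (forall i, i < N -> p' i = p i) -> exec p' c s t.
Proof.
elim=> {c s t} [i s|i s|i s|c d s t u _ [N IHc] _ [M IHd]|i c s s0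
    |i c s t u s0 _ [N IHc] _ [M IHw]].
- by exists 0 => p' _; apply: exec_inc.
- by exists 0 => p' _; apply: exec_dec.
- by exists (s i).+1 => p' pp'; rewrite -pp' //; apply: exec_ask.
- exists (maxn N M) => p' pp'; apply: (@exec_seq _ _ _ _ t).
  + by apply: IHc => i iN; apply: pp'; rewrite leq_max iN.
  + by apply: IHd => i iM; apply: pp'; rewrite leq_max iM orbT.
- by exists 0 => p' _; apply: exec_stop.
- exists (maxn N M) => p' pp'; apply: (@exec_loop _ _ _ _ t) => //.
  + by apply: IHc => j jN; apply: pp'; rewrite leq_max jN.
  + by apply: IHw => j jM; apply: pp'; rewrite leq_max jM orbT.
Qed.

Lemma finitely_reduced_cofinal (A : set nat) (b : nat -> bool) M :
  (forall i, b i -> A i) -> (forall i, M <= i -> A i -> b i) ->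
  finitely_reduced A (fun i => b i).
Proof.
move=> bA Ab; exists [set i | A i /\ ~~ b i]; split.
- apply: (@sub_finite_set _ _ `I_M); last exact: finite_II.
  move=> i [Ai nbi] /=; rewrite ltnNge; apply: contra nbi => Mi.
  exact: Ab.
- by move=> i [].
- move=> i; rewrite /char_fun; case: asboolP => [[_ /negPf ->]//|nF].
  case: asboolP => [Ai|nAi]; last by case: (boolP (b i)) => // /bA.
  by case: (boolP (b i)) => // nb; case: nF.
Qed.

Definition join (p q : nat -> bool) : baire :=
  fun k => if odd k then q k./2 else p k./2.

Lemma join_names (X Y : repSpace) (p q : nat -> bool) (x : X) (y : Y) :
  names (fun n => p n) x -> names (fun n => q n) y ->
  @names (prod_space X Y) (join p q) (x, y).
Proof.
move=> px qy; split => /=; rewrite /join.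
- by under eq_fun do rewrite odd_double doubleK.
- by under eq_fun do rewrite /= odd_double uphalf_double.
Qed.

(** This is the unfolded [computably_hausdorff X] with the program [c] fixed. *)
Definition separates (c : prog) (X : repSpace) : Prop :=
  forall p (z : prod_space X X), names p z ->
  exists2 q, computes c p q & sierpinski_names q `[< z.1 <> z.2 >].

(** Quantifying over all [A] that contain the 1s of [s] makes the defeat of [c] survive every later
    extension of [s]. *)
Definition defeats (c : prog) (s : seq bool) : Prop :=
  forall (A : set nat) (infA : infinite_set A) (coinfA : infinite_set (~` A)),
  (forall i, i < size s -> nth false s i -> A i) ->
  ~ separates c (D_space infA coinfA).

Lemma defeats_dense c s : exists t, defeats c (s ++ t).
Proof.
set n := size s.
pose up (g : nat -> bool) i := (n <= i) && g i.
pose accepts p := exists k t,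
  exec p c [eta (fun=> 0) with 0 |-> k] t /\ t 0 <> 0.
have [[g [k [t [ct t0]]]]|rejects] :=
  pselect (exists g, accepts (join (up g) (up (negb \o g)))).
- have [N useN] := exec_use ct.
  exists (nseq N true) => A infA coinfA sA sep.
  (* Since [A] contains all of [[n, n + N[], any pattern [b] on that interval, blank below [n] and
     continued by [A], is a name of [pt_a]. *)
  have below (b : nat -> bool) : finitely_reduced A
      (fun i => if i < n + N then up b i else `[< A i >]).
    pose b' i := if i < n + N then up b i else `[< A i >].
    apply: (@finitely_reduced_cofinal A b' (n + N)) => i.
      rewrite /b'; case: ltnP => [iN /andP[ni _]|_ /asboolP //].
      apply: sA; first by rewrite size_cat size_nseq.
      by rewrite nth_cat ltnNge ni /= nth_nseq ltn_subLR // iN.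
    by rewrite /b' leqNgt => /negPf -> Ai; apply/asboolP.
  have [q cq] := sep _ _ (@join_names (D_space infA coinfA)
    (D_space infA coinfA) _ _ pt_a pt_a (below g) (below (negb \o g))).
  rewrite asboolF /=; last by apply.
  move=> [/(_ erefl) q0 _].
  have [u cu u0] := cq k.
  (* This oracle agrees below [N] with the accepted one, so the run ending in [t 0 <> 0] carries
     over, against [q k = 0]. *)
  suff ct' : exec (join (fun i => if i < n + N then up g i else `[< A i >])
      (fun i => if i < n + N then up (negb \o g) i else `[< A i >]))
      c [eta (fun=> 0) with 0 |-> k] t.
    by apply: t0; rewrite (exec_det ct' cu) u0 q0.
  apply: useN => i iN; rewrite /join.
  suff -> : i./2 < n + N by [].
  by rewrite (leq_trans _ (leq_addl n N)) // (leq_ltn_trans _ iN) // leq_half_double -addnn leqW ?leq_addl.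
(* The partition tested is that of [A] itself: a nonzero output on this name of [(pt_a, pt_b)]
   contradicts [rejects]. *)
- exists [::] => A infA coinfA _ sep.
  pose g i := `[< A i >].
  have na : finitely_reduced A (fun i => up g i).
    apply: (@finitely_reduced_cofinal A (up g) n) => i.
      by case/andP => _ /asboolP.
    by move=> ni Ai; rewrite /up ni; apply/asboolP.
  have nb : finitely_reduced (~` A) (fun i => up (negb \o g) i).
    apply: (@finitely_reduced_cofinal (~` A) (up (negb \o g)) n) => i.
      by case/andP => _ /asboolPn.
    by move=> ni Ai; rewrite /up ni; apply/asboolPn.
  have [q cq] := sep _ _ (@join_names (D_space infA coinfA)
    (D_space infA coinfA) _ _ pt_a pt_b na nb).
  rewrite asboolT //= => -[_ qN].
  suff /qN : forall k, q k = 0 by [].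
  move=> k; have [u cu u0] := cq k.
  have [//|qk] := eqVneq (q k) 0; case: rejects.
  by exists g, k, u; split=> //; rewrite u0; apply/eqP.
Qed.

Lemma cofinal_infinite (A : set nat) :
  (forall k, exists2 i, k <= i & A i) -> infinite_set A.
Proof.
move=> Acof /finite_seqP[r Ar].
have [i ri] := Acof (\max_(j <- r) j).+1.
rewrite Ar /= => ir.
by move: ri; rewrite ltnNge (@leq_bigmax_seq nat r xpredT id i).
Qed.

Theorem proposition30 :
  exists (A : set nat) (infA : infinite_set A) (coinfA : infinite_set (~` A)),
    ~ computably_hausdorff (D_space infA coinfA).
Proof.
(* Besides one requirement per program, [inr (b, k)] asks for the bit [b] at some position from [k]
   on; this makes the set infinite and co-infinite. *)
pose U (r : prog + bool * nat) (s : seq bool) : Prop := match r with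
  | inl c => defeats c s
  | inr (b, k) => exists i, [/\ k <= i, i < size s & nth false s i = b]
  end.
have [[c|[b k]] s|g gU] := @generic_sequence _ U.
- exact: defeats_dense.
(* Of the [k + 1] copies of [b], the last stands at position [size s + k]. *)
- exists (rcons (nseq k b) b); exists (size s + k); split.
  + exact: leq_addl.
  + by rewrite size_cat size_rcons size_nseq addnS.
  + by rewrite nth_cat ltnNge leq_addr /= addKn nth_rcons size_nseq ltnn eqxx.
have cofinal b k : exists2 i, k <= i & g i = b.
  have [m [i [ki]]] := gU (inr (b, k)); rewrite size_mkseq => im.
  by rewrite nth_mkseq // => gi; exists i.
have infA : infinite_set [set i | g i].
  by apply: cofinal_infinite => k; have [i ? ?] := cofinal true k; exists i.
have coinfA : infinite_set (~` [set i | g i]).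
  apply: cofinal_infinite => k; have [i ? gi] := cofinal false k.
  by exists i => //=; rewrite gi.
exists [set i | g i], infA, coinfA => -[c sep].
have [m] := gU (inl c).
apply: (_ : defeats c _ -> _) => /(_ _ infA coinfA); apply; last exact: sep.
by rewrite size_mkseq => i im; rewrite nth_mkseq.
Qed.
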